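(* Let $q,\rho_1,\rho_2$ be real with $|q|<1$, $|\rho_1|<1$, $|\rho_2|<1$, $\rho_1\ne0$, $\rho_2\neq 0$, and let $x,y,z\in S(q)=[-2/\sqrt{1-q},\,2/\sqrt{1-q}]$. Then $$0\le\sum_{n\ge0}\frac{\rho_1^n}{[n]_q!\,(\rho_2^2;q)_n}P_n(x|y,\rho_2,q)\,P_n\!\left(z\Big|y,\frac{\rho_2}{\rho_1},q\right)=\frac{(\rho_1^2;q)_\infty}{(\rho_2^2;q)_\infty}\prod_{k=0}^\infty\frac{w(x,y,\rho_2q^k|q)}{w(x,z,\rho_1q^k|q)},$$ and consequently $$1=\left(\sum_{n\ge0}\frac{\rho_1^n}{[n]_q!\,(\rho_2^2;q)_n}P_n(x|y,\rho_2,q)P_n\!\left(z\Big|y,\frac{\rho_2}{\rho_1},q\right)\right)\left(\sum_{n\ge0}\frac{\rho_2^n}{[n]_q!\,(\rho_1^2;q)_n}P_n(x|z,\rho_1,q)P_n\!\left(y\Big|z,\frac{\rho_1}{\rho_2},q\right)\right).$$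
   Context: Conventions: $0^0=1$. $[0]_q=0$, $[n]_q=1+q+\dots+q^{n-1}$ for $n\ge1$, $[n]_q!=\prod_{i=1}^n[i]_q$ with $[0]_q!=1$. The $q$-Pochhammer symbol is $(c;q)_n=\prod_{i=0}^{n-1}(1-cq^i)$, $(c;q)_0=1$, $(c;q)_\infty=\prod_{i\ge0}(1-cq^i)$. Al-Salam--Chihara polynomials $P_n(x|y,\rho,q)$, for every real $\rho$ (including $|\rho|\ge1$): $P_0=1$, $P_1(x|y,\rho,q)=x-\rho y$, and for $n\ge1$ $$P_{n+1}(x|y,\rho,q)=(x-\rho yq^n)P_n(x|y,\rho,q)-[n]_q(1-\rho^2q^{n-1})P_{n-1}(x|y,\rho,q).$$ Equivalently, $P_n(x|y,\rho,q)=\sum_{i=0}^n\binom{n}{i}_q\rho^{n-i}B_{n-i}(y|q)H_i(x|q)$, where $\binom{n}{i}_q=\frac{[n]_q!}{[n-i]_q!\,[i]_q!}$; $H_{-1}(x|q)=0$, $H_0(x|q)=1$, $H_{n+1}(x|q)=xH_n(x|q)-[n]_qH_{n-1}(x|q)$ for $n\ge0$; and $B_0(x|q)=1$, $B_1(x|q)=-x$, $B_{n+1}(x|q)=-q^nxB_n(x|q)+q^{n-1}[n]_qB_{n-1}(x|q)$ for $n\ge1$. Finally $w(x,y,\rho|q)=(1-\rho^2)^2-(1-q)\rho(1+\rho^2)xy+(1-q)\rho^2(x^2+y^2)$. *)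

(* Defs.v *)
From mathcomp Require Import all_boot all_order all_algebra.
From mathcomp Require Import all_classical all_reals all_analysis.
Import Order.TTheory GRing.Theory Num.Theory.
Import numFieldNormedType.Exports.

Set Implicit Arguments.
Unset Strict Implicit.
Unset Printing Implicit Defensive.

Local Open Scope classical_set_scope.
Local Open Scope ring_scope.

(* [x ^+ 0 = 1] for every [x], so [0 ^+ 0 = 1]; this matters when [q = 0]. *)

Definition qint (R : realType) (q : R) (n : nat) : R :=
  \sum_(0 <= i < n) q ^+ i.

Definition qfact (R : realType) (q : R) (n : nat) : R :=
  \prod_(1 <= i < n.+1) qint q i.

Definition qpoch (R : realType) (c q : R) (n : nat) : R :=
  \prod_(0 <= i < n) (1 - c * q ^+ i).

(* [infprod u] is the limit of the partial products of [u]; [limn] is a total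
   function, so the convergence of the partial products has to be asserted
   separately. *)
Definition partial_prod (R : realType) (u : R^nat) : R^nat :=
  fun n => \prod_(0 <= k < n) u k.

Definition infprod (R : realType) (u : R^nat) : R := limn (partial_prod u).

Definition qpoch_inf (R : realType) (c q : R) : R :=
  infprod (fun i => 1 - c * q ^+ i).

(* Al-Salam--Chihara polynomials P_n(x|y,rho,q), for arbitrary real [rho]. *)
Fixpoint asc (R : realType) (q rho y x : R) (n : nat) : R :=
  match n with
  | 0 => 1
  | m.+1 =>
      match m with
      | 0 => x - rho * y
      | k.+1 =>
          (x - rho * y * q ^+ m) * asc q rho y x m
          - qint q m * (1 - rho ^+ 2 * q ^+ k) * asc q rho y x k
      end
  end.

Definition wfun (R : realType) (q x y rho : R) : R :=
  (1 - rho ^+ 2) ^+ 2 - (1 - q) * rho * (1 + rho ^+ 2) * x * y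
  + (1 - q) * rho ^+ 2 * (x ^+ 2 + y ^+ 2).

Definition Sq (R : realType) (q : R) : set R :=
  `[- (2 / Num.sqrt (1 - q)), 2 / Num.sqrt (1 - q)]%classic.

Definition asc_term (R : realType) (q x y z rho1 rho2 : R) : R^nat :=
  fun n => rho1 ^+ n / (qfact q n * qpoch (rho2 ^+ 2) q n)
           * asc q rho2 y x n * asc q (rho2 / rho1) y z n.

(* Main.v *)
(* In the variables X = sqrt(1-q) x etc., let h_n and b_n be the rescaled H_n
   and B_n, p_n = P_n(x|y,r,q) / (r^2;q)_n and c_m = r^m b_m(Y) / (q;q)_m.
   Since t^n P_n(z|y,r/t,q) / (q;q)_n is the convolution of t^i h_i(Z) / (q;q)_i
   with c_m, the series of the theorem equals
     sum_i t^i h_i(Z) / (q;q)_i * S_i,   S_i = sum_m c_m p_(m+i).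
   Abel summation shows S_(i+1) = X S_i - (1 - q^i) S_(i-1), so S_i = h_i(X) S_0
   and the series is M(X,Z,t) S_0(X,Y,r), with M the Poisson-Mehler kernel.
   At Z = Y, t = r every term but the first vanishes, so S_0(X,Y,r) is the
   inverse of M(X,Y,r), and the series is M(X,Z,t) / M(X,Y,r). The product
   formula for M comes from iterating its q-difference equation
   w(t) M(t) = (1 - t^2) (1 - q t^2) M(q t). *)

Require Import Defs.
From mathcomp Require Import all_boot all_order all_algebra.
From mathcomp Require Import all_classical all_reals all_analysis.
From mathcomp Require Import ring lra.
Import Order.TTheory GRing.Theory Num.Theory.
Import numFieldNormedType.Exports.
Set Implicit Arguments.
Unset Strict Implicit.
Unset Printing Implicit Defensive.
Local Open Scope classical_set_scope.
Local Open Scope ring_scope.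

(** * Geometric bounds, series and infinite products *)

Lemma geometric_bound_cvg (R : realType) (u : R^nat) (C k : R) :
  0 <= k -> k < 1 -> (forall n, `|u n| <= C * k ^+ n) -> cvgn (series u).
Proof.
move=> k0 k1 hu; apply: normed_cvg.
apply: (@series_le_cvg _ _ (geometric C k)).
- by move=> n /=; exact: normr_ge0.
- by move=> n /=; apply: le_trans (hu n); exact: normr_ge0.
- by move=> n; exact: hu.
- by apply: is_cvg_geometric_series; rewrite ger0_norm.
Qed.

Lemma geometric_bound_tail (R : realType) (u : R^nat) (C k : R) (N : nat) :
  0 <= k -> k < 1 -> (forall n, `|u n| <= C * k ^+ n) ->
  `|limn (series u) - series u N| <= C * k ^+ N / (1 - k).
Proof.
move=> k0 k1 hu.
have C0 : 0 <= C by have := le_trans (normr_ge0 _) (hu 0%N); rewrite expr0 mulr1.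
have cu := geometric_bound_cvg k0 k1 hu.
have k1' : 1 - k != 0 by rewrite subr_eq0 gt_eqF.
have step m : `|series u (m + N)%N - series u N|
               <= C * k ^+ N * (1 - k ^+ m) / (1 - k).
  elim: m => [|m IH]; first by rewrite add0n subrr normr0 expr0 subrr mulr0 mul0r.
  rewrite addSn seriesSr addrAC; apply: le_trans (ler_normD _ _) _.
  apply: le_trans (lerD IH (hu _)) _.
  rewrite le_eqVlt; apply/orP; left; apply/eqP.
  by rewrite exprD exprS; field.
have cv : (fun n => `|series u n - series u N|) @ \oo
            --> `|limn (series u) - series u N|.
  by apply: cvg_norm; apply: cvgB => //; exact: cvg_cst.
rewrite -(cvg_lim _ cv) //; apply: limr_le; first by apply/cvg_ex; eexists; exact: cv.
exists N => // n /= Nn; rewrite -(subnK Nn); apply: le_trans (step _) _.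
apply: ler_wpM2r; first by rewrite invr_ge0; lra.
apply: ler_piMr; first by rewrite mulr_ge0 ?exprn_ge0.
by have := exprn_ge0 (n - N) k0; lra.
Qed.

Lemma geometric_increments_cvg (R : realType) (u : R^nat) (C k : R) :
  0 <= k -> k < 1 -> (forall n, `|u n.+1 - u n| <= C * k ^+ n) -> cvgn u.
Proof.
move=> k0 k1 hu.
have -> : u = (fun n => u 0%N + series (telescope u) n).
  by apply/funext => n; exact: eq_sum_telescope.
apply: is_cvgD; first exact: is_cvg_cst.
by apply: (geometric_bound_cvg k0 k1) => n; exact: hu.
Qed.

Lemma partial_prodS (R : realType) (f : R^nat) (n : nat) :
  partial_prod f n.+1 = partial_prod f n * f n.
Proof. by rewrite /partial_prod big_nat_recr. Qed.

(** From [1 + x <= expR x] applied to each factor; the exponents add up to a partial geometric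
    sum. *)
Lemma partial_prod_bounded (R : realType) (f : R^nat) (K r : R) :
  0 <= r -> r < 1 -> (forall n, `|f n - 1| <= K * r ^+ n) ->
  forall n, `|partial_prod f n| <= expR (K / (1 - r)).
Proof.
move=> r0 r1 hf n.
have K0 : 0 <= K by have := le_trans (normr_ge0 _) (hf 0%N); rewrite expr0 mulr1.
have r1' : 1 - r != 0 by rewrite subr_eq0 gt_eqF.
have : `|partial_prod f n| <= expR (K * (1 - r ^+ n) / (1 - r)).
  elim: n => [|n IH].
    by rewrite /partial_prod big_nil normr1 expr0 subrr mulr0 mul0r expR0.
  rewrite partial_prodS normrM.
  have -> : K * (1 - r ^+ n.+1) / (1 - r)
            = K * (1 - r ^+ n) / (1 - r) + K * r ^+ n by rewrite exprS; field.
  rewrite expRD; apply: ler_pM => //.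
  have -> : f n = 1 + (f n - 1) by ring.
  apply: le_trans (ler_normD _ _) _; rewrite normr1.
  by apply: le_trans (expR_ge1Dx _); rewrite lerD2l.
move/le_trans; apply; rewrite ler_expR; apply: ler_wpM2r.
  by rewrite invr_ge0; lra.
by apply: ler_piMr => //; have := exprn_ge0 n r0; lra.
Qed.

Lemma partial_prod_cvg (R : realType) (f : R^nat) (K r : R) :
  0 <= r -> r < 1 -> (forall n, `|f n - 1| <= K * r ^+ n) ->
  cvgn (partial_prod f).
Proof.
move=> r0 r1 hf.
apply: (@geometric_increments_cvg _ _ (expR (K / (1 - r)) * K) r) => // n.
rewrite partial_prodS -{2}[partial_prod f n]mulr1 -mulrBr normrM -mulrA.
by apply: ler_pM => //; exact: partial_prod_bounded hf n.
Qed.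

(** The reciprocals of the factors are also geometrically close to 1, with constant [K / c], so the
    upper bound for their product inverts to a lower bound here. *)
Lemma partial_prod_lower (R : realType) (f : R^nat) (K r c : R) :
  0 <= r -> r < 1 -> 0 < c -> (forall n, c <= f n) ->
  (forall n, `|f n - 1| <= K * r ^+ n) ->
  exists2 d : R, 0 < d & forall n, d <= partial_prod f n.
Proof.
move=> r0 r1 c0 cf hf.
have f0 n : 0 < f n by apply: lt_le_trans (cf n).
have hV n : `|(f n)^-1 - 1| <= K / c * r ^+ n.
  have -> : (f n)^-1 - 1 = - ((f n - 1) / f n).
    by field; rewrite gt_eqF.
  rewrite normrN normrM [X in _ * X]ger0_norm ?invr_ge0 ?(ltW (f0 n)) // mulrAC.
  apply: ler_pM => //; first by rewrite invr_ge0 (ltW (f0 n)).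
  by rewrite lef_pV2 ?posrE.
exists (expR (K / c / (1 - r)))^-1; first by rewrite invr_gt0 expR_gt0.
move=> n; have P0 : 0 < partial_prod f n.
  by rewrite /partial_prod; apply: prodr_gt0.
rewrite -[leRHS]invrK lef_pV2 ?posrE ?invr_gt0 ?expR_gt0 //.
apply: le_trans (partial_prod_bounded r0 r1 hV n).
apply: le_trans (ler_norm _).
by rewrite /partial_prod prodfV.
Qed.

Lemma geometric_small (R : realType) (K r d : R) :
  0 <= r -> r < 1 -> 0 < d ->
  exists N, forall n, (N <= n)%N -> K * r ^+ n <= d.
Proof.
move=> r0 r1 d0.
have /cvgr0_norm_le : geometric K r @ \oo --> (0 : R).
  by apply: cvg_geometric; rewrite ger0_norm.
move=> /(_ _ d0) [N _ hN]; exists N => n Nn.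
by apply: le_trans (ler_norm _) (hN n Nn).
Qed.

Lemma eventually_geometric_bound (R : realType) (v : R^nat) (s : R) (N : nat) :
  0 < s -> (forall n, 0 <= v n) -> (forall n, (N <= n)%N -> v n.+1 <= s * v n) ->
  exists2 C : R, 0 <= C & forall n, v n <= C * s ^+ n.
Proof.
(* The sum dominates each ratio [v i / s ^+ i] with [i <= N]; beyond [N] the hypothesis propagates
   the bound. *)
move=> s0 v0 hv; exists (\sum_(i < N.+1) v i / s ^+ i).
  by apply: sumr_ge0 => i _; apply: divr_ge0 => //; apply: exprn_ge0; exact: ltW.
have small n : (n < N.+1)%N -> v n <= (\sum_(i < N.+1) v i / s ^+ i) * s ^+ n.
  move=> nN; rewrite -ler_pdivrMr ?exprn_gt0 // (bigD1 (Ordinal nN)) //= lerDl.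
  by apply: sumr_ge0 => i _; apply: divr_ge0 => //; apply: exprn_ge0; exact: ltW.
elim=> [|n IH]; first exact: small.
case: (ltnP n N) => nN; first exact: small.
apply: le_trans (hv _ nN) _; rewrite exprS mulrCA.
by apply: ler_wpM2l => //; exact: ltW.
Qed.

(** * Growth of perturbed three-term recurrences *)

Definition energy (R : realFieldType) (X eta p r : R) : R :=
  p ^+ 2 - X * p * r + r ^+ 2 + eta ^+ 2 * r ^+ 2.

(** The unperturbed step preserves [E = p^2 - X p r + r^2], so only [eta^2 r^2] changes, into
    [eta^2 p^2]. Completing the square, [E = a^2 + (1 - X^2/4) r^2] with [a = p - X r / 2], which
    bounds [a] and hence [p]. *)
Lemma energy_bounds (R : realFieldType) (X eta p r : R) :
  0 < eta -> eta <= 1 -> `|X| <= 2 ->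
  [/\ energy X eta (X * p - r) p <= (1 + 2 * eta) * energy X eta p r,
      (p - X * r / 2) ^+ 2 <= energy X eta p r &
      eta ^+ 2 * (p ^+ 2 + r ^+ 2) <= 3 * energy X eta p r].
Proof.
move=> e0 e1 hX.
have hX2 : X ^+ 2 <= 4.
  by rewrite -[X ^+ 2]real_normK ?num_real //; have := normr_ge0 X; nra.
set E := p ^+ 2 - X * p * r + r ^+ 2.
set a := p - X * r / 2; set b := X * r / 2.
have EE : E = a ^+ 2 + (1 - X ^+ 2 / 4) * r ^+ 2 by rewrite /E /a; field.
have r2 : 0 <= r ^+ 2 by exact: sqr_ge0.
have a2 : 0 <= a ^+ 2 by exact: sqr_ge0.
have aE : a ^+ 2 <= E.
  by rewrite EE lerDl; apply: mulr_ge0 => //; lra.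
have E0 : 0 <= E by apply: le_trans aE.
have b2 : b ^+ 2 <= r ^+ 2.
  have -> : b ^+ 2 = (X ^+ 2 / 4) * r ^+ 2 by rewrite /b; field.
  by rewrite ler_piMl //; lra.
(* Young's inequality for [p = a + b] with weights [1 + 1/eta] and [1 + eta], multiplied by
   [eta^2]. *)
have ep : eta ^+ 2 * p ^+ 2
          <= (eta + eta ^+ 2) * a ^+ 2 + (1 + eta) * (eta ^+ 2 * b ^+ 2).
  rewrite -subr_ge0.
  have -> : (eta + eta ^+ 2) * a ^+ 2 + (1 + eta) * (eta ^+ 2 * b ^+ 2)
            - eta ^+ 2 * p ^+ 2 = eta * (a - eta * b) ^+ 2.
    by rewrite /a /b; field.
  by apply: mulr_ge0; [exact: ltW|exact: sqr_ge0].
set f := eta ^+ 2 * r ^+ 2.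
have f0 : 0 <= f by apply: mulr_ge0 => //; exact: sqr_ge0.
have eb : eta ^+ 2 * b ^+ 2 <= f by apply: ler_wpM2l => //; exact: sqr_ge0.
have ee : eta ^+ 2 <= eta by rewrite expr2; apply: ler_piMl => //; exact: ltW.
have V_E : energy X eta p r = E + f by [].
have ep1 : eta ^+ 2 * p ^+ 2 <= 2 * eta * E + (1 + eta) * f.
  apply: le_trans ep _; apply: lerD.
    apply: ler_pM => //; last by lra.
    by have := sqr_ge0 eta; lra.
  by apply: ler_wpM2l => //; lra.
have eE : eta * E <= E by apply: ler_piMl.
have ef : eta * f <= f by apply: ler_piMl.
have ef0 : 0 <= eta * f by apply: mulr_ge0 => //; exact: ltW.
split.
- have -> : energy X eta (X * p - r) p = E + eta ^+ 2 * p ^+ 2.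
    by rewrite /energy /E; ring.
  by rewrite V_E; lra.
- by rewrite V_E; lra.
- by rewrite V_E mulrDr -/f; lra.
Qed.

(** The perturbation adds [2 g e + e^2], where [g^2] is at most the unperturbed energy [W]. Young's
    inequality with weight [eta] and [W <= 3 V] bound the total growth by [2 eta + 3 eta + 0.6 eta],
    below [6 eta]. *)
Lemma energy_step (R : realFieldType) (X eta p r e : R) :
  0 < eta -> eta <= 1 -> `|X| <= 2 ->
  e ^+ 2 <= eta ^+ 4 / 10 * (p ^+ 2 + r ^+ 2) ->
  energy X eta (X * p - r + e) p <= (1 + 6 * eta) * energy X eta p r.
Proof.
move=> e0 e1 hX he.
have [h1 _ h3] := energy_bounds p r e0 e1 hX.
have [_ h2 _] := energy_bounds (X * p - r) p e0 e1 hX.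
set V := energy X eta p r in h1 h3 *.
set W := energy X eta (X * p - r) p in h1 h2 *.
set g := X * p - r - X * p / 2 in h2.
have -> : energy X eta (X * p - r + e) p = W + (2 * g * e + e ^+ 2).
  by rewrite /W /energy /g; field.
have V0 : 0 <= V.
  suff : 0 <= 3 * V by lra.
  by apply: le_trans h3; rewrite mulr_ge0 ?addr_ge0 ?sqr_ge0.
have ge : 2 * g * e <= eta * g ^+ 2 + e ^+ 2 / eta.
  rewrite -subr_ge0.
  have -> : eta * g ^+ 2 + e ^+ 2 / eta - 2 * g * e
            = (eta * g - e) ^+ 2 / eta by field; rewrite gt_eqF.
  by rewrite divr_ge0 ?sqr_ge0 // ltW.
have e2V : e ^+ 2 <= 3 / 10 * eta * (eta * V).
  apply: le_trans he _.
  have -> : eta ^+ 4 / 10 * (p ^+ 2 + r ^+ 2)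
    = eta ^+ 2 / 10 * (eta ^+ 2 * (p ^+ 2 + r ^+ 2)) by field.
  have -> : 3 / 10 * eta * (eta * V) = eta ^+ 2 / 10 * (3 * V) by field.
  by apply: ler_wpM2l => //; apply: divr_ge0 => //; exact: sqr_ge0.
have eV : 0 <= eta * V by apply: mulr_ge0 => //; exact: ltW.
have e2e : e ^+ 2 / eta <= 3 / 10 * (eta * V).
  by rewrite ler_pdivrMr // mulrAC.
have e2e' : e ^+ 2 <= 3 / 10 * (eta * V).
  apply: le_trans e2V _; apply: ler_wpM2r => //; lra.
have gW : eta * g ^+ 2 <= eta * W by rewrite ler_pM2l.
have W3 : eta * W <= eta * (3 * V).
  rewrite ler_pM2l //; apply: le_trans h1 _; apply: ler_wpM2r => //; lra.
lra.
Qed.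

(* The characteristic roots of u(n+2) = X u(n+1) - u(n) have modulus 1 for
   |X| <= 2; at |X| = 2 the conserved form p^2 - X p r + r^2 is degenerate,
   hence the extra eta^2 r^2 in [energy]. *)
Lemma perturbed_recurrence_growth (R : realType) (X K k s : R) (a b u : R^nat) :
  `|X| <= 2 -> 0 <= k -> k < 1 -> 1 < s ->
  (forall n, `|a n| <= K * k ^+ n) -> (forall n, `|b n| <= K * k ^+ n) ->
  (forall n, u n.+2 = (X - a n) * u n.+1 - (1 - b n) * u n) ->
  exists2 C : R, 0 <= C & forall n, `|u n| <= C * s ^+ n.
Proof.
move=> hX k0 k1 s1 ha hb hu.
(* The energy is quadratic in [u], so it may grow by [s^2] per step; for [eta = (s - 1) / 3] the
   factor is [2 s - 1 <= s^2]. *)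
have [eta [e0 e1 es]] : exists eta : R, [/\ 0 < eta, eta <= 1 & 1 + 6 * eta <= s ^+ 2].
  case: (leP ((s - 1) / 3) 1) => h.
    by exists ((s - 1) / 3); split => //; [lra|nra].
  by exists 1; split => //; nra.
(* Coefficients below [eta^2 / 5] have squares below [eta^4 / 25]; doubled by the square of a sum,
   this stays within the [eta^4 / 10] of [energy_step]. *)
have d0 : 0 < eta ^+ 2 / 5 by rewrite divr_gt0 ?exprn_gt0.
have [N hN] := geometric_small K k0 k1 d0.
pose v n := energy X eta (u n.+1) (u n).
have v_lb n : (eta ^+ 2 * (u n) ^+ 2) <= 3 * v n.
  have [_ _ h] := energy_bounds (u n.+1) (u n) e0 e1 hX.
  apply: le_trans h; apply: ler_wpM2l; first exact: sqr_ge0.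
  by rewrite lerDr sqr_ge0.
have v0 n : 0 <= v n.
  suff : 0 <= 3 * v n by lra.
  by apply: le_trans (v_lb n); rewrite mulr_ge0 ?sqr_ge0.
have s0 : 0 < s by lra.
have [n Nn|C C0 hC] := @eventually_geometric_bound _ v (s ^+ 2) N (exprn_gt0 _ s0) v0.
  apply: (@le_trans _ _ ((1 + 6 * eta) * v n)); last exact: ler_wpM2r.
  rewrite /v; have -> : u n.+2 = X * u n.+1 - u n + (b n * u n - a n * u n.+1).
    by rewrite hu; ring.
  apply: energy_step => //.
  have sq (c : R) : `|c| <= K * k ^+ n -> c ^+ 2 <= eta ^+ 4 / 25.
    move=> /le_trans -/(_ _ (hN n Nn)) hc.
    have -> : eta ^+ 4 / 25 = (eta ^+ 2 / 5) ^+ 2 by field.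
    by rewrite -[c ^+ 2]real_normK ?num_real // ler_sqr ?nnegrE // ltW.
  have := sq _ (ha n); have := sq _ (hb n) => hb2 ha2.
  have := ler_wpM2r (sqr_ge0 (u n)) hb2.
  have := ler_wpM2r (sqr_ge0 (u n.+1)) ha2.
  have := sqr_ge0 (b n * u n + a n * u n.+1).
  have h4 : 0 <= eta ^+ 4 * (u n) ^+ 2 by rewrite mulr_ge0 ?sqr_ge0 // exprn_ge0 // ltW.
  have h5 : 0 <= eta ^+ 4 * (u n.+1) ^+ 2 by rewrite mulr_ge0 ?sqr_ge0 // exprn_ge0 // ltW.
  have -> : (b n * u n - a n * u n.+1) ^+ 2 = 2 * (a n ^+ 2 * u n.+1 ^+ 2)
     + 2 * (b n ^+ 2 * u n ^+ 2) - (b n * u n + a n * u n.+1) ^+ 2 by ring.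
  by rewrite mulrDr; lra.
have D0 : 0 <= 3 * C / eta ^+ 2 by rewrite divr_ge0 ?sqr_ge0 // mulr_ge0.
(* With [D = 3 C / eta^2], the inequality [D <= (1 + D)^2] avoids a square root. *)
exists (1 + 3 * C / eta ^+ 2); first by lra.
move=> n; rewrite -ler_sqr ?nnegrE ?normr_ge0 //; last first.
  by rewrite mulr_ge0 ?exprn_ge0 //; lra.
rewrite real_normK ?num_real //.
have h1 : u n ^+ 2 <= 3 * C / eta ^+ 2 * (s ^+ n) ^+ 2.
  rewrite -(ler_pM2l (exprn_gt0 2 e0)); apply: le_trans (v_lb n) _.
  have -> : eta ^+ 2 * (3 * C / eta ^+ 2 * (s ^+ n) ^+ 2)
            = 3 * (C * (s ^+ 2) ^+ n).
    by rewrite -!exprM [(2 * n)%N]mulnC; field; rewrite gt_eqF.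
  by rewrite ler_pM2l.
apply: le_trans h1 _; rewrite exprMn; apply: ler_wpM2r; first exact: sqr_ge0.
set D := 3 * C / _ in D0 *; nra.
Qed.

(** Once both coefficients are at most 1/2 in modulus, the maximum of two consecutive [|u n|] no
    longer increases. *)
Lemma vanishing_recurrence_bounded (R : realType) (K k : R) (a b u : R^nat) :
  0 <= k -> k < 1 ->
  (forall n, `|a n| <= K * k ^+ n) -> (forall n, `|b n| <= K * k ^+ n) ->
  (forall n, u n.+2 = a n * u n.+1 + b n * u n) ->
  exists2 C : R, 0 <= C & forall n, `|u n| <= C.
Proof.
move=> k0 k1 ha hb hu.
have d0 : (0 : R) < 1 / 2 by lra.
have [N hN] := geometric_small K k0 k1 d0.
pose v n := Num.max `|u n| `|u n.+1|.
have v0 n : 0 <= v n by rewrite /v le_max normr_ge0.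
have [n Nn|C C0 hC] := @eventually_geometric_bound _ v 1 N ltr01 v0.
  have h1 : `|u n| <= v n by rewrite /v le_max lexx.
  have h2 : `|u n.+1| <= v n by rewrite /v le_max lexx orbT.
  rewrite mul1r {1}/v ge_max h2 /= hu.
  apply: le_trans (ler_normD _ _) _; rewrite !normrM.
  have hh := hN n Nn.
  have h3 : `|a n| * `|u n.+1| <= 1 / 2 * v n.
    by apply: ler_pM => //; apply: le_trans (ha n) hh.
  have h4 : `|b n| * `|u n| <= 1 / 2 * v n.
    by apply: ler_pM => //; apply: le_trans (hb n) hh.
  lra.
exists C => // n; have := hC n; rewrite expr1n mulr1; apply: le_trans.
by rewrite /v le_max lexx.
Qed.

(** * Homogeneous Al-Salam--Chihara polynomials *)

(* The polynomials t^n (1-q)^(n/2) P_n(x|y,r/t,q) in the variables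
   X = sqrt(1-q) x, Y = sqrt(1-q) y; they are homogeneous in (t, r) and also
   make sense at t = 0, where they reduce to the rescaled r^n B_n(y|q), while
   r = 0 gives the rescaled t^n H_n(x|q). *)
Fixpoint asc2 (R : realType) (q t X r Y : R) (n : nat) : R :=
  match n with
  | 0 => 1
  | m.+1 =>
      match m with
      | 0 => t * X - r * Y
      | k.+1 =>
          (t * X - r * Y * q ^+ m) * asc2 q t X r Y m
          - (1 - q ^+ m) * (t ^+ 2 - r ^+ 2 * q ^+ k) * asc2 q t X r Y k
      end
  end.

Lemma asc2SS (R : realType) (q t X r Y : R) (n : nat) :
  asc2 q t X r Y n.+2 =
  (t * X - r * Y * q ^+ n.+1) * asc2 q t X r Y n.+1
  - (1 - q ^+ n.+1) * (t ^+ 2 - r ^+ 2 * q ^+ n) * asc2 q t X r Y n.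
Proof. by []. Qed.

Lemma nat_ind2 (P : nat -> Prop) :
  P 0%N -> P 1%N -> (forall n, P n -> P n.+1 -> P n.+2) -> forall n, P n.
Proof.
move=> P0 P1 PS n; suff [] : P n /\ P n.+1 by [].
by elim: n => // n [h1 h2]; split => //; exact: PS.
Qed.

Lemma asc2_scale (R : realType) (q s t X r Y : R) (n : nat) :
  asc2 q (s * t) X (s * r) Y n = s ^+ n * asc2 q t X r Y n.
Proof.
elim/nat_ind2: n => [|/=|n h1 h2]; first by rewrite mul1r.
  by ring.
by rewrite !asc2SS h1 h2 !exprS; ring.
Qed.

Lemma qint_mul (R : realType) (q : R) (n : nat) : qint q n * (1 - q) = 1 - q ^+ n.
Proof.
rewrite /qint; elim: n => [|n IH]; first by rewrite big_nil expr0; ring.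
by rewrite big_nat_recr //= mulrDl IH exprS; ring.
Qed.

Lemma asc_asc2 (R : realType) (q t x r y k : R) (n : nat) :
  k ^+ 2 = 1 - q -> t != 0 ->
  k ^+ n * t ^+ n * asc q (r / t) y x n = asc2 q t (k * x) r (k * y) n.
Proof.
move=> hk t0; elim/nat_ind2: n => [|/=|n h1 h2]; first by rewrite /=; ring.
  by field.
rewrite asc2SS -h1 -h2 -(qint_mul q n.+1) -hk.
have -> : asc q (r / t) y x n.+2 =
  (x - r / t * y * q ^+ n.+1) * asc q (r / t) y x n.+1
  - qint q n.+1 * (1 - (r / t) ^+ 2 * q ^+ n) * asc q (r / t) y x n by [].
by rewrite !exprS; field.
Qed.

(** * The q-Pochhammer symbols: recurrences, convergence and positivity *)

Lemma qpochS (R : realType) (c q : R) (n : nat) :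
  qpoch c q n.+1 = qpoch c q n * (1 - c * q ^+ n).
Proof. by rewrite /qpoch big_nat_recr. Qed.

Lemma qpoch0 (R : realType) (c q : R) : qpoch c q 0 = 1.
Proof. by rewrite /qpoch big_nil. Qed.

Lemma qfact_mul (R : realType) (q : R) (n : nat) :
  qfact q n * (1 - q) ^+ n = qpoch q q n.
Proof.
elim: n => [|n IH]; first by rewrite /qfact big_nil qpoch0 mul1r.
have -> : qfact q n.+1 = qfact q n * qint q n.+1 by rewrite /qfact big_nat_recr.
by rewrite qpochS -(exprS q n) -qint_mul -IH exprS; ring.
Qed.

Lemma qfactor_ge (R : realType) (c q : R) (n : nat) :
  `|q| < 1 -> 1 - `|c| <= 1 - c * q ^+ n.
Proof.
move=> hq; rewrite lerD2l lerN2.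
apply: le_trans (ler_norm _) _; rewrite normrM normrX.
by apply: ler_piMr => //; apply: exprn_ile1 => //; exact: ltW.
Qed.

Lemma qfactor_near1 (R : realType) (c q : R) (n : nat) :
  `|(1 - c * q ^+ n) - 1| <= `|c| * `|q| ^+ n.
Proof.
have -> : (1 - c * q ^+ n) - 1 = - (c * q ^+ n) by ring.
by rewrite normrN normrM normrX.
Qed.

Lemma qpoch_cvg (R : realType) (c q : R) : `|q| < 1 -> cvgn (qpoch c q).
Proof.
move=> hq; apply: (@partial_prod_cvg _ (fun i => 1 - c * q ^+ i) `|c| `|q|) => //.
by move=> n; exact: qfactor_near1.
Qed.

Lemma qpoch_lower (R : realType) (c q : R) : `|q| < 1 -> `|c| < 1 ->
  exists2 d : R, 0 < d & forall n, d <= qpoch c q n.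
Proof.
move=> hq hc; apply: (@partial_prod_lower _ (fun i => 1 - c * q ^+ i) `|c| `|q| (1 - `|c|)) => //.
- by rewrite subr_gt0.
- by move=> n; exact: qfactor_ge.
- by move=> n; exact: qfactor_near1.
Qed.

Lemma qpoch_gt0 (R : realType) (c q : R) (n : nat) :
  `|q| < 1 -> `|c| < 1 -> 0 < qpoch c q n.
Proof.
by move=> hq hc; have [d d0 hd] := qpoch_lower hq hc; exact: lt_le_trans (hd n).
Qed.

Lemma qpoch_inf_gt0 (R : realType) (c q : R) :
  `|q| < 1 -> `|c| < 1 -> 0 < qpoch_inf c q.
Proof.
move=> hq hc; have [d d0 hd] := qpoch_lower hq hc.
apply: lt_le_trans d0 _; apply: limr_ge; first exact: qpoch_cvg.
by exists 0%N => // n _; exact: hd.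
Qed.

Lemma subr1X_neq0 (R : realType) (q : R) (n : nat) : `|q| < 1 -> 1 - q ^+ n.+1 != 0.
Proof.
move=> hq; rewrite exprS gt_eqF //; apply: lt_le_trans (qfactor_ge q n hq).
by rewrite subr_gt0.
Qed.

Lemma qpochqqS (R : realType) (q : R) (n : nat) :
  qpoch q q n.+1 = qpoch q q n * (1 - q ^+ n.+1).
Proof. by rewrite qpochS exprS. Qed.

(** * Coefficient sequences as formal power series, and their q-difference equation *)

Definition seqshift (R : realType) (a : R^nat) : R^nat :=
  fun n => if n is m.+1 then a m else 0.

(** On generating functions in a variable z this is the substitution of qz for z, while [seqshift]
    is multiplication by z and [convol] is the product. *)
Definition qdil (R : realType) (q : R) (a : R^nat) : R^nat := fun n => q ^+ n * a n.

Definition convol (R : realType) (a b : R^nat) : R^nat :=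
  fun n => \sum_(i < n.+1) a i * b (n - i)%N.

Lemma convol_shiftl (R : realType) (a b : R^nat) : convol (seqshift a) b = seqshift (convol a b).
Proof.
apply/funext => -[|n]; rewrite /convol big_ord_recl /= mul0r add0r //.
by rewrite big_ord0.
Qed.

Lemma convolC (R : realType) (a b : R^nat) : convol a b = convol b a.
Proof.
apply/funext => n; rewrite /convol (reindex_inj rev_ord_inj) /=.
apply: eq_bigr => i _; rewrite subSS mulrC; congr (_ * _).
by rewrite subKn // -ltnS.
Qed.

Lemma convol_shiftr (R : realType) (a b : R^nat) : convol a (seqshift b) = seqshift (convol a b).
Proof. by rewrite convolC convol_shiftl convolC. Qed.

Lemma convol_qdil (R : realType) (q : R) (a b : R^nat) :
  convol (qdil q a) (qdil q b) = qdil q (convol a b).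
Proof.
apply/funext => n; rewrite /convol /qdil mulr_sumr; apply: eq_bigr => i _.
by rewrite mulrACA -exprD subnKC // -ltnS.
Qed.

(* asc2 / (q;q)_n is the power series solution of this q-difference equation. *)
Definition asc2_eq (R : realType) (q t X r Y : R) (g : R^nat) : Prop :=
  forall n, (1 - q ^+ n) * g n =
    t * X * seqshift g n - t ^+ 2 * seqshift (seqshift g) n
    - r * Y * seqshift (qdil q g) n + r ^+ 2 * seqshift (seqshift (qdil q g)) n.

Lemma asc2_eq_uniq (R : realType) (q t X r Y : R) (f g : R^nat) :
  `|q| < 1 -> asc2_eq q t X r Y f -> asc2_eq q t X r Y g -> f 0%N = g 0%N ->
  f =1 g.
Proof.
move=> hq hf hg h0 n; elim/nat_ind2: n => // [|n h1 h2].
  apply: (mulfI (subr1X_neq0 0 hq)).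
  by rewrite hf hg /= /qdil h0.
apply: (mulfI (subr1X_neq0 n.+1 hq)).
by rewrite hf hg /= /qdil h1 h2.
Qed.

Lemma asc2_eq_asc2 (R : realType) (q t X r Y : R) : `|q| < 1 ->
  asc2_eq q t X r Y (fun n => asc2 q t X r Y n / qpoch q q n).
Proof.
move=> hq n; have P m : qpoch q q m != 0 by rewrite gt_eqF // qpoch_gt0.
case: n => [|[|n]]; rewrite /seqshift /qdil.
- by ring.
- have -> : asc2 q t X r Y 1 = t * X - r * Y by [].
  have -> : asc2 q t X r Y 0 = 1 by [].
  rewrite qpochqqS qpoch0; field; exact: subr1X_neq0 0%N hq.
- rewrite !qpochqqS asc2SS; have h1 := subr1X_neq0 n hq.
  have h2 := subr1X_neq0 n.+1 hq; have h3 := P n.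
  rewrite -!/(asc2 _ _ _ _ _ _); field; by rewrite h1 h2 h3.
Qed.

(** For generating functions, [asc2_eq] reads [(1 - t X z + t^2 z^2) g(z) = (1 - r Y z + r^2 z^2)
    g(q z)]. The factor [d] carries the left quadratic and [c] the right one, so their product
    satisfies the full equation. *)
Lemma asc2_eq_convol (R : realType) (q t X r Y X' Y' : R) (d c : R^nat) :
  asc2_eq q t X 0 Y' d -> asc2_eq q 0 X' r Y c -> asc2_eq q t X r Y (convol d c).
Proof.
move=> hd hc n.
rewrite -convol_qdil -(convol_shiftl d c) -(convol_shiftl (seqshift d) c).
rewrite -!(convol_shiftr (qdil q d)).
(* A q-Leibniz rule: [1 - q^n = (1 - q^i) + q^i (1 - q^(n-i))]. *)
have -> : (1 - q ^+ n) * convol d c n = convol (fun i => (1 - q ^+ i) * d i) c n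
          + convol (qdil q d) (fun i => (1 - q ^+ i) * c i) n.
  rewrite /convol mulr_sumr -big_split /=; apply: eq_bigr => i _.
  have -> : q ^+ n = q ^+ i * q ^+ (n - i) by rewrite -exprD subnKC // -ltnS.
  by rewrite /qdil; ring.
rewrite /convol !mulr_sumr -!sumrN -!big_split /=; apply: eq_bigr => i _.
by rewrite hd hc; ring.
Qed.

Lemma asc2_convol (R : realType) (q t X r Y : R) (n : nat) : `|q| < 1 ->
  convol (fun i => asc2 q t X 0 0 i / qpoch q q i)
       (fun m => asc2 q 0 0 r Y m / qpoch q q m) n
  = asc2 q t X r Y n / qpoch q q n.
Proof.
move=> hq; apply: (asc2_eq_uniq hq (asc2_eq_convol (@asc2_eq_asc2 _ q t X 0 0 hq)
  (@asc2_eq_asc2 _ q 0 0 r Y hq)) (@asc2_eq_asc2 _ q t X r Y hq)).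
by rewrite /convol big_ord_recl big_ord0 /= qpoch0; field.
Qed.

(** The degree-one polynomial vanishes, and the factor [r^2 - r^2 q^0] removes the degree-zero one
    from the next step. This evaluation normalises [mehler_inv]. *)
Lemma asc2_diag (R : realType) (q r Y : R) (n : nat) : asc2 q r Y r Y n.+1 = 0.
Proof.
elim/nat_ind2: n => [/=|/=|n h1 h2]; first by ring.
  by ring.
by rewrite asc2SS h1 h2; ring.
Qed.

(** * The series in terms of the Poisson-Mehler kernel *)

Lemma geometric_bound_cvg0 (R : realType) (u : R^nat) (C k : R) :
  0 <= k -> k < 1 -> (forall n, `|u n| <= C * k ^+ n) -> u @ \oo --> (0 : R).
Proof.
by move=> k0 k1 hu; apply: cvg_series_cvg_0; exact: geometric_bound_cvg hu.
Qed.

Lemma series0 (R : realType) (u : R^nat) : series u 0%N = 0.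
Proof. by rewrite /series /= big_geq. Qed.

(* Abel summation: by the recurrences of c and p, the coefficient of each
   p(m + i) on the left cancels, up to the boundary terms. *)
Lemma shifted_series_recurrence (R : realType) (q X X' r Y : R) (c p : R^nat) :
  asc2_eq q 0 X' r Y c ->
  (forall n, (1 - r ^+ 2 * q ^+ n) * p n.+1 =
     (X - r * Y * q ^+ n) * p n - (1 - q ^+ n) * p n.-1) ->
  forall i M,
  series (fun m => c m * p (m + i.+1)%N) M
  - X * series (fun m => c m * p (m + i)%N) M
  + (1 - q ^+ i) * series (fun m => c m * p (m + i.-1)%N) M
  = q ^+ i * (r ^+ 2 * seqshift (qdil q c) M * p (M + i)%N
              + (1 - q ^+ M) * c M * p (M + i).-1).
Proof.
move=> hc hp i; elim=> [|M IH]; first by rewrite !series0 /= expr0 subrr; ring.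
have hcM : (1 - q ^+ M.+1) * c M.+1
           = - (r * Y * (q ^+ M * c M)) + r ^+ 2 * seqshift (qdil q c) M.
  by rewrite hc /= -[qdil q c M]/(q ^+ M * c M); ring.
rewrite !seriesSr addSn /= -[qdil q c M]/(q ^+ M * c M) hcM.
have hpM := hp (M + i)%N.
(* The two indices differ at [i = 0], where the predecessor is truncated, but there the coefficient
   [1 - q ^+ 0] is zero. *)
have hi : (1 - q ^+ i) * p (M + i.-1)%N = (1 - q ^+ i) * p (M + i).-1.
  by case: (i) => [|j]; [rewrite expr0 subrr !mul0r|rewrite addnS].
rewrite addnS; move: hpM IH hi; rewrite !exprD.
set P := p (M + i).-1; set P' := p (M + i.-1)%N.
move=> hpM IH hi.
have hi2 := congr1 (fun z => c M * z) hi.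
have hp2 := congr1 (fun z => c M * z) hpM.
rewrite /= in hi2 hp2.
lra.
Qed.

(** The decay [k^(2m)] of [c] absorbs the growth [k^(-m)] of [p] and leaves a summable [k^m]. *)
Lemma mul_expr_bound (R : realType) (k C D : R) (c p : R^nat) (i m : nat) :
  0 < k -> (forall m, `|c m| <= C * (k ^+ 2) ^+ m) ->
  (forall n, `|p n| <= D * k^-1 ^+ n) ->
  `|c m * p (m + i)%N| <= C * D * k^-1 ^+ i * k ^+ m.
Proof.
move=> k0 hc hp; rewrite normrM.
have -> : C * D * k^-1 ^+ i * k ^+ m = (C * (k ^+ 2) ^+ m) * (D * k^-1 ^+ (m + i)).
  rewrite exprD !exprVn -exprM mulnC exprM.
  by field; rewrite !expf_neq0 ?gt_eqF.
exact: ler_pM.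
Qed.

Lemma shifted_series_cvg (R : realType) (k C D : R) (c p : R^nat) (i : nat) :
  0 < k -> k < 1 -> (forall m, `|c m| <= C * (k ^+ 2) ^+ m) ->
  (forall n, `|p n| <= D * k^-1 ^+ n) ->
  cvgn (series (fun m => c m * p (m + i)%N)).
Proof.
move=> k0 k1 hc hp; apply: (geometric_bound_cvg (ltW k0) k1) => m.
exact: mul_expr_bound.
Qed.

(** The boundary terms of the Abel summation tend to 0, so the limits obey the recurrence of
    [asc2 q 1 X 0 0]; at [i = 0] it already gives [S 1 = X * S 0], so [S 0] determines them all. *)
Lemma shifted_series_lim (R : realType) (q X X' r Y k C D : R) (c p : R^nat) :
  asc2_eq q 0 X' r Y c ->
  (forall n, (1 - r ^+ 2 * q ^+ n) * p n.+1 =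
     (X - r * Y * q ^+ n) * p n - (1 - q ^+ n) * p n.-1) ->
  `|q| < 1 ->
  0 < k -> k < 1 -> (forall m, `|c m| <= C * (k ^+ 2) ^+ m) ->
  (forall n, `|p n| <= D * k^-1 ^+ n) ->
  forall i, limn (series (fun m => c m * p (m + i)%N))
            = asc2 q 1 X 0 0 i * limn (series (fun m => c m * p m)).
Proof.
move=> hc hp hq k0 k1 bc bp.
pose S i := limn (series (fun m => c m * p (m + i)%N)).
have cS i : series (fun m => c m * p (m + i)%N) @ \oo --> S i.
  exact: shifted_series_cvg bc bp.
have rec i : S i.+1 = X * S i - (1 - q ^+ i) * S i.-1.
  suff: S i.+1 - X * S i + (1 - q ^+ i) * S i.-1 = 0 by lra.
  pose u M := series (fun m => c m * p (m + i.+1)%N) M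
     - X * series (fun m => c m * p (m + i)%N) M
     + (1 - q ^+ i) * series (fun m => c m * p (m + i.-1)%N) M.
  have cL : u @ \oo --> S i.+1 - X * S i + (1 - q ^+ i) * S i.-1.
    by apply: cvgD; [apply: cvgB => //|]; apply: cvgM => //; exact: cvg_cst.
  apply: (cvg_unique _ cL) => //.
  suff : (fun M => u M.+1) @ \oo --> (0 : R) by rewrite cvg_shiftS.
  have -> : (fun M => u M.+1)
     = (fun M => q ^+ i * (r ^+ 2 * (q ^+ M * (c M * p (M + i.+1)%N))
              + (1 - q ^+ M.+1) * (c M.+1 * p (M.+1 + i).-1))).
    apply/funext => M; rewrite /u (shifted_series_recurrence hc hp) /= /qdil.
    by rewrite addSnnS; ring.
  rewrite -[X in _ --> X](mulr0 (q ^+ i)); apply: cvgM; first exact: cvg_cst.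
  rewrite -[X in _ --> X](addr0 0); apply: cvgD.
    rewrite -[X in _ --> X](mulr0 (r ^+ 2)); apply: cvgM; first exact: cvg_cst.
    apply: (geometric_bound_cvg0 (ltW k0) k1) => M.
    rewrite normrM; apply: le_trans (mul_expr_bound i.+1 M k0 bc bp).
    by apply: ler_piMl => //; rewrite normrX; apply: exprn_ile1 => //; exact: ltW.
  apply: (@geometric_bound_cvg0 _ _ (2 * (C * k ^+ 2 * D * k^-1 ^+ i)) k (ltW k0) k1) => M.
  rewrite addSn /= normrM.
  have b1 : `|1 - q ^+ M.+1| <= 2.
    apply: le_trans (ler_normB _ _) _; rewrite normr1 normrX.
    by have := exprn_ile1 M.+1 (normr_ge0 q) (ltW hq); lra.
  have b2 : `|c M.+1 * p (M + i)%N| <= C * k ^+ 2 * D * k^-1 ^+ i * k ^+ M.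
    apply: (@mul_expr_bound _ k (C * k ^+ 2) D (fun m => c m.+1)) => // m.
    by rewrite -mulrA -exprS.
  have := ler_pM (normr_ge0 _) (normr_ge0 _) b1 b2 => /le_trans; apply.
  by rewrite !mulrA.
have S0 : limn (series (fun m => c m * p m)) = S 0%N.
  by rewrite /S; congr (limn (series _)); apply/funext => m; rewrite addn0.
rewrite S0 => i; rewrite -/(S i); elim/nat_ind2: i => [|/=|i h1 h2].
- by rewrite mul1r.
- by rewrite rec expr0 subrr; ring.
- by rewrite asc2SS rec succnK h1 h2; ring.
Qed.

(** The triangle [i + m < N] is summed along [i] instead of along [n = i + m]. *)
Lemma kernel_partial_sum (R : realType) (c d p : R^nat) (N : nat) :
  series (fun n => p n * convol d c n) N
  = \sum_(i < N) d i * series (fun m => c m * p (m + i)%N) (N - i)%N.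
Proof.
elim: N => [|N IH]; first by rewrite series0 big_ord0.
rewrite seriesSr IH big_ord_recr /= subSnn seriesSr series0 add0r add0n.
rewrite /convol big_ord_recr /= subnn mulrDr addrA; congr (_ + _); last by ring.
rewrite mulr_sumr -big_split /=; apply: eq_bigr => i _.
have iN : (i <= N)%N by exact: ltnW.
by rewrite subSn // seriesSr subnK //; ring.
Qed.

(** Replacing each inner partial sum by its limit costs a tail of order [k^(-i) k^(N-i)]. Against
    [d i] of order [k^(3i)] this leaves [k^N k^i], whose sum over [i] tends to 0 with [N]. *)
Lemma kernel_series_cvg (R : realType) (k A C D S M : R) (c d p h : R^nat) :
  0 < k -> k < 1 -> (forall m, `|c m| <= C * (k ^+ 2) ^+ m) ->
  (forall n, `|p n| <= D * k^-1 ^+ n) ->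
  (forall n, `|d n| <= A * (k ^+ 3) ^+ n) ->
  (forall i, limn (series (fun m => c m * p (m + i)%N)) = h i * S) ->
  series (fun n => d n * h n) @ \oo --> M ->
  series (fun n => p n * convol d c n) @ \oo --> M * S.
Proof.
move=> k0 k1 bc bp bd hS hM.
have D0 : 0 <= D by have := le_trans (normr_ge0 _) (bp 0%N); rewrite expr0 mulr1.
have C0 : 0 <= C by have := le_trans (normr_ge0 _) (bc 0%N); rewrite expr0 mulr1.
have A0 : 0 <= A by have := le_trans (normr_ge0 _) (bd 0%N); rewrite expr0 mulr1.
have k1' : 0 < 1 - k by rewrite subr_gt0.
pose e N := series (fun n => p n * convol d c n) N - series (fun n => d n * h n) N * S.
have he : e @ \oo --> (0 : R).
  apply: (@geometric_bound_cvg0 _ _ (A * (C * D) / (1 - k) / (1 - k)) k (ltW k0) k1) => N.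
  have -> : e N = \sum_(i < N) d i * (series (fun m => c m * p (m + i)%N) (N - i)%N
                      - limn (series (fun m => c m * p (m + i)%N))).
    rewrite /e kernel_partial_sum /series /= big_mkord mulr_suml -sumrB.
    by apply: eq_bigr => i _; rewrite hS; ring.
  apply: le_trans (ler_norm_sum _ _ _) _.
  apply: (@le_trans _ _ (\sum_(i < N) (A * (C * D) / (1 - k) * k ^+ N) * k ^+ i)).
    apply: ler_sum => i _; rewrite normrM.
    have iN : (i <= N)%N by exact: ltnW.
    have := @geometric_bound_tail _ _ _ k (N - i) (ltW k0) k1
      (fun m => mul_expr_bound i m k0 bc bp).
    rewrite distrC => ht.
    apply: le_trans (ler_pM (normr_ge0 _) (normr_ge0 _) (bd i) ht) _.
    have -> : k ^+ N = k ^+ (N - i) * k ^+ i by rewrite -exprD subnK.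
    rewrite exprVn -exprM mulnC exprM.
    rewrite le_eqVlt; apply/orP; left; apply/eqP.
    by field; rewrite (gt_eqF k1') expf_neq0 // gt_eqF.
  rewrite -mulr_sumr [leRHS]mulrAC.
  apply: ler_wpM2l.
    by rewrite !mulr_ge0 ?exprn_ge0 ?invr_ge0 // ltW.
  have := @geometric_le_lim R N 1 k ler01 k0.
  rewrite ger0_norm ?(ltW k0) // => /(_ k1); rewrite mul1r /series /= big_mkord.
  apply: le_trans; apply: ler_sum => i _; by rewrite /geometric /= mul1r.
have -> : series (fun n => p n * convol d c n)
          = (fun N => e N + series (fun n => d n * h n) N * S).
  by apply/funext => N; rewrite /e subrK.
rewrite -[X in _ --> X]add0r; apply: cvgD => //.
by apply: cvgM => //; exact: cvg_cst.
Qed.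

(** * The Poisson-Mehler formula *)

(** At [t = 1] the recurrence differs from [u(n+2) = X u(n+1) - u(n)] by coefficients of order
    [|q|^n]. *)
Lemma asc2_growth (R : realType) (q X r Y s : R) :
  `|q| < 1 -> `|X| <= 2 -> 1 < s ->
  exists2 C : R, 0 <= C & forall n, `|asc2 q 1 X r Y n| <= C * s ^+ n.
Proof.
move=> hq hX s1.
pose K := `|r * Y| + 1 + 2 * r ^+ 2.
have Q n : `|q ^+ n| <= 1 by rewrite normrX; apply: exprn_ile1 => //; exact: ltW.
have qS n : `|q ^+ n.+1| <= `|q| ^+ n.
  by rewrite normrX exprS; apply: ler_piMl; [exact: exprn_ge0|exact: ltW].
apply: (@perturbed_recurrence_growth _ X K `|q| s (fun n => r * Y * q ^+ n.+1)
  (fun n => 1 - (1 - q ^+ n.+1) * (1 - r ^+ 2 * q ^+ n))) => // n.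
- rewrite normrM; apply: ler_pM => //.
  by rewrite /K -addrA lerDl; have := sqr_ge0 r; lra.
- have -> : 1 - (1 - q ^+ n.+1) * (1 - r ^+ 2 * q ^+ n)
    = q ^+ n.+1 + r ^+ 2 * (1 - q ^+ n.+1) * q ^+ n by ring.
  apply: (@le_trans _ _ (1 * `|q| ^+ n + 2 * r ^+ 2 * `|q| ^+ n)).
    apply: le_trans (ler_normD _ _) _; apply: lerD; first by rewrite mul1r.
    rewrite normrM normrX; apply: ler_wpM2r; first exact: exprn_ge0.
    rewrite normrM ger0_norm ?sqr_ge0 // mulrC; apply: ler_wpM2r; first exact: sqr_ge0.
    by apply: le_trans (ler_normB _ _) _; rewrite normr1; have := Q n.+1; lra.
  rewrite -mulrDl; apply: ler_wpM2r; first exact: exprn_ge0.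
  by rewrite /K -addrA lerDr.
- by rewrite asc2SS; ring.
Qed.

(** At [t = 0] both recurrence coefficients decay like [|q|^n]. The case [r = 1] suffices by
    [asc2_scale]. *)
Lemma asc2_0_bounded (R : realType) (q X Y : R) : `|q| < 1 ->
  exists2 C : R, 0 <= C & forall n, `|asc2 q 0 X 1 Y n| <= C.
Proof.
move=> hq.
have Q n : `|q ^+ n| <= 1 by rewrite normrX; apply: exprn_ile1 => //; exact: ltW.
apply: (@vanishing_recurrence_bounded _ (`|Y| + 2) `|q| (fun n => - Y * q ^+ n.+1)
  (fun n => (1 - q ^+ n.+1) * q ^+ n)) => // n.
- rewrite normrM normrN normrX; apply: ler_pM => //; first by rewrite lerDl.
  by rewrite exprS; apply: ler_piMl; [exact: exprn_ge0|exact: ltW].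
- rewrite normrM normrX; apply: ler_wpM2r; first exact: exprn_ge0.
  apply: le_trans (ler_normB _ _) _; rewrite normr1.
  by have := Q n.+1; have := normr_ge0 Y; lra.
- by rewrite asc2SS; ring.
Qed.

Definition mehler_coef (R : realType) (q X Y : R) : R^nat :=
  fun n => asc2 q 1 X 0 0 n * asc2 q 1 Y 0 0 n / qpoch q q n.

Definition mehler (R : realType) (q X Y t : R) : R^nat :=
  fun n => t ^+ n * mehler_coef q X Y n.

Lemma mehler_coef_growth (R : realType) (q X Y s : R) :
  `|q| < 1 -> `|X| <= 2 -> `|Y| <= 2 -> 1 < s ->
  exists2 C : R, 0 <= C & forall n, `|mehler_coef q X Y n| <= C * (s ^+ 2) ^+ n.
Proof.
move=> hq hX hY s1.
have [A A0 hA] := asc2_growth 0 0 hq hX s1.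
have [B B0 hB] := asc2_growth 0 0 hq hY s1.
have [d d0 hd] := qpoch_lower hq hq.
exists (A * B / d); first by rewrite !mulr_ge0 ?invr_ge0 // ltW.
move=> n; rewrite /mehler_coef !normrM normfV.
have -> : A * B / d * s ^+ 2 ^+ n = A * s ^+ n * (B * s ^+ n) / d.
  by rewrite -exprM mulnC exprM; ring.
apply: ler_pM; rewrite ?mulr_ge0 ?invr_ge0 //; first by apply: ler_pM.
rewrite lef_pV2 ?posrE //; last by rewrite normr_gt0 gt_eqF // qpoch_gt0.
exact: le_trans (hd n) (ler_norm _).
Qed.

(* The recurrence of order 4 satisfied by the product of two solutions of
   recurrences of order 2; it is the q-difference equation of the
   Poisson-Mehler kernel read off coefficientwise. *)
Lemma mehler_coef_recurrence (R : realType) (q X Y : R) (n : nat) : `|q| < 1 ->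
  let g := mehler_coef q X Y in
  g n - qdil q g n - X * Y * seqshift g n
  + (X ^+ 2 + Y ^+ 2 - 2) * seqshift (seqshift g) n
  + (1 + q) * seqshift (seqshift (qdil q g)) n
  - X * Y * seqshift (seqshift (seqshift g)) n
  + seqshift (seqshift (seqshift (seqshift g))) n
  - q * seqshift (seqshift (seqshift (seqshift (qdil q g)))) n = 0.
Proof.
move=> hq g.
have f m := subr1X_neq0 m hq.
have A m : qpoch q q m != 0 by rewrite gt_eqF // qpoch_gt0.
have H0 (Z : R) : asc2 q 1 Z 0 0 0 = 1 by [].
have H1 (Z : R) : asc2 q 1 Z 0 0 1 = Z by rewrite /=; ring.
have HS (Z : R) m : asc2 q 1 Z 0 0 m.+2
    = Z * asc2 q 1 Z 0 0 m.+1 - (1 - q ^+ m.+1) * asc2 q 1 Z 0 0 m.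
  by rewrite asc2SS; ring.
have f1 : 1 - q != 0 by have := f 0%N; rewrite expr1.
have f2 : 1 - q * q != 0 by have := f 1%N; rewrite expr2.
have f3 : 1 - q * (q * q) != 0 by have := f 2%N; rewrite !exprS expr0 mulr1.
case: n => [|[|[|[|n]]]]; rewrite /seqshift /qdil /g /mehler_coef.
- by rewrite H0 qpoch0; field.
- by rewrite H0 !H1 qpochqqS qpoch0 !exprS expr0 !mulr1; field.
- rewrite !HS H0 !H1 !qpochqqS qpoch0 !exprS expr0 !mulr1; field.
  by rewrite f1 f2.
- rewrite !HS H0 !H1 !qpochqqS qpoch0 !exprS expr0 !mulr1; field.
  by rewrite f1 f2 f3.
(* Every value reduces to two consecutive ones in each of [X] and [Y]; with these as free variables
   the identity is rational. *)
- rewrite !HS !qpochqqS.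
  move: (A n) (f n) (f n.+1) (f n.+2) (f n.+3); rewrite !exprS.
  move: (asc2 q 1 X 0 0 n) (asc2 q 1 X 0 0 n.+1) (asc2 q 1 Y 0 0 n)
    (asc2 q 1 Y 0 0 n.+1) (qpoch q q n) (q ^+ n) => x0 x1 y0 y1 a Q a0 e1 e2 e3 e4.
  by field; rewrite a0 e1 e2 e3 e4.
Qed.

(** The function w in the rescaled variables, expanded in [t]. For [X = 2 cos a], [Y = 2 cos b] it
    is the product of [1 - 2 t cos(a + b) + t^2] and [1 - 2 t cos(a - b) + t^2]. *)
Definition wnorm (R : realType) (X Y t : R) : R :=
  1 - X * Y * t + (X ^+ 2 + Y ^+ 2 - 2) * t ^+ 2 - X * Y * t ^+ 3 + t ^+ 4.

(** Provides a rate with several powers to spare. Bernoulli's inequality [(1 - e)^4 >= 1 - 4 e]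
    replaces the extraction of a root. *)
Lemma fourth_root_bound (R : realType) (a : R) : 0 <= a -> a < 1 ->
  exists k : R, [/\ 0 < k, k < 1 & a <= k ^+ 4].
Proof.
move=> a0 a1; set e := (1 - a) / 4; exists (1 - e).
have ea : a = 1 - 4 * e by rewrite /e; field.
have e0 : 0 < e by rewrite /e; lra.
have e1 : e <= 1 / 4 by rewrite /e; lra.
split; [lra|lra|].
rewrite -subr_ge0; have -> : (1 - e) ^+ 4 - a = e ^+ 2 * (6 - 4 * e) + (e ^+ 2) ^+ 2.
  by rewrite ea; ring.
by apply: addr_ge0; [apply: mulr_ge0; [exact: sqr_ge0|lra]|exact: sqr_ge0].
Qed.

Lemma mehler_bound (R : realType) (q X Y k : R) :
  `|q| < 1 -> `|X| <= 2 -> `|Y| <= 2 -> 0 < k -> k < 1 ->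
  exists2 C : R, 0 <= C &
    forall u n, `|mehler q X Y u n| <= C * (`|u| * k^-1 ^+ 2) ^+ n.
Proof.
move=> hq hX hY k0 k1.
have s1 : 1 < k^-1 by rewrite invf_gt1.
have [C C0 hC] := mehler_coef_growth hq hX hY s1.
exists C => // u n; rewrite /mehler normrM normrX exprMn mulrCA.
by apply: ler_wpM2l => //; exact: exprn_ge0.
Qed.

Lemma mehler_cvg (R : realType) (q X Y t : R) :
  `|q| < 1 -> `|X| <= 2 -> `|Y| <= 2 -> `|t| < 1 -> cvgn (series (mehler q X Y t)).
Proof.
move=> hq hX hY ht.
have [k [k0 k1 tk]] := fourth_root_bound (normr_ge0 t) ht.
have [C C0 hC] := mehler_bound hq hX hY k0 k1.
have kV : 0 <= k^-1 by rewrite invr_ge0 ltW.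
apply: (@geometric_bound_cvg _ _ C (`|t| * k^-1 ^+ 2)) => //.
  by rewrite mulr_ge0 ?exprn_ge0.
rewrite exprVn ltr_pdivrMr ?exprn_gt0 // mul1r; apply: le_lt_trans tk _.
have -> : k ^+ 4 = k ^+ 2 * k ^+ 2 by ring.
by rewrite gtr_pMr ?exprn_gt0 // exprn_ilt1 // ltW.
Qed.

(** The constant term of the kernel is 1 and the remaining terms form a geometric tail whose ratio
    is at most [k^2 |q|^N]. *)
Lemma mehler_near0 (R : realType) (q X Y t : R) :
  `|q| < 1 -> `|X| <= 2 -> `|Y| <= 2 -> `|t| < 1 ->
  exists C : R, forall N,
    `|limn (series (mehler q X Y (t * q ^+ N))) - 1| <= C * `|q| ^+ N.
Proof.
move=> hq hX hY ht.
have [k [k0 k1 tk]] := fourth_root_bound (normr_ge0 t) ht.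
have [C C0 hC] := mehler_bound hq hX hY k0 k1.
have k2 : k ^+ 2 < 1 by rewrite exprn_ilt1 // ltW.
have kV : 0 <= k^-1 by rewrite invr_ge0 ltW.
exists (C * k ^+ 2 / (1 - k ^+ 2)) => N.
set u := t * q ^+ N; set K := `|u| * k^-1 ^+ 2.
have K0 : 0 <= K by rewrite mulr_ge0 ?exprn_ge0.
have KN : K <= k ^+ 2 * `|q| ^+ N.
  rewrite /K /u normrM normrX mulrAC; apply: ler_wpM2r; first exact: exprn_ge0.
  rewrite exprVn ler_pdivrMr ?exprn_gt0 //.
  by apply: le_trans tk _; rewrite le_eqVlt; apply/orP; left; apply/eqP; ring.
have Kk : K <= k ^+ 2.
  apply: le_trans KN _; apply: ler_piMr; first exact: sqr_ge0.
  by apply: exprn_ile1 => //; exact: ltW.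
have K1 : K < 1 by lra.
have := geometric_bound_tail 1 K0 K1 (hC u).
have -> : series (mehler q X Y u) 1%N = 1.
  by rewrite seriesSr series0 /mehler /mehler_coef /= qpoch0; field.
move/le_trans; apply; rewrite expr1.
have -> : C * k ^+ 2 / (1 - k ^+ 2) * `|q| ^+ N
  = C * (k ^+ 2 * `|q| ^+ N) / (1 - k ^+ 2) by ring.
apply: ler_pM; [exact: mulr_ge0|by rewrite invr_ge0; lra|exact: ler_wpM2l|].
rewrite lef_pV2 ?posrE; lra.
Qed.

Lemma seqshift_series_cvg (R : realType) (a : R^nat) (l : R) :
  series a @ \oo --> l -> series (seqshift a) @ \oo --> l.
Proof.
move=> ha; rewrite -cvg_shiftS.
have -> : (fun n => series (seqshift a) n.+1) = series a; last by [].
apply/funext => n; elim: n => [|n IH]; first by rewrite seriesSr !series0 /= addr0.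
by rewrite seriesSr IH [RHS]seriesSr.
Qed.

(** The recurrence of [mehler_coef] is multiplied by [t^n] and summed. Prepending zeros leaves a sum
    unchanged, so all shifts of one series contribute the same limit. *)
Lemma mehler_qdiff (R : realType) (q X Y t : R) :
  `|q| < 1 -> `|X| <= 2 -> `|Y| <= 2 -> `|t| < 1 ->
  wnorm X Y t * limn (series (mehler q X Y t))
  = (1 - t ^+ 2) * (1 - t ^+ 2 * q) * limn (series (mehler q X Y (t * q))).
Proof.
move=> hq hX hY ht.
have htq : `|t * q| < 1.
  rewrite normrM; apply: le_lt_trans ht; apply: ler_piMr => //; exact: ltW.
set a := mehler q X Y t; set A := limn (series a).
set b := mehler q X Y (t * q); set B := limn (series b).
have ca : series a @ \oo --> A by exact: mehler_cvg.
have cb : series b @ \oo --> B by exact: mehler_cvg.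
pose sh := @seqshift R.
have pt n : a n - b n - X * Y * t * sh a n + (X ^+ 2 + Y ^+ 2 - 2) * t ^+ 2 * sh (sh a) n
  + (1 + q) * t ^+ 2 * sh (sh b) n - X * Y * t ^+ 3 * sh (sh (sh a)) n
  + t ^+ 4 * sh (sh (sh (sh a))) n - q * t ^+ 4 * sh (sh (sh (sh b))) n = 0.
  have /= := congr1 (fun z => t ^+ n * z) (mehler_coef_recurrence X Y n hq).
  rewrite mulr0 => <-.
  by case: n => [|[|[|[|n]]]]; rewrite /sh /seqshift /qdil /a /b /mehler !exprMn;
    set g := mehler_coef q X Y; rewrite ?exprS; ring.
pose s c := series (sh c).
have cs (c : R^nat) (l : R) : series c @ \oo --> l -> s c @ \oo --> l by exact: seqshift_series_cvg.
have cZ (z : R) (f : R^nat) (l : R) : f @ \oo --> l -> (fun n => z * f n) @ \oo --> z * l.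
  by move=> hf; apply: cvgM => //; exact: cvg_cst.
have cL : (fun N => series a N - series b N - X * Y * t * s a N
  + (X ^+ 2 + Y ^+ 2 - 2) * t ^+ 2 * s (sh a) N
  + (1 + q) * t ^+ 2 * s (sh b) N - X * Y * t ^+ 3 * s (sh (sh a)) N
  + t ^+ 4 * s (sh (sh (sh a))) N - q * t ^+ 4 * s (sh (sh (sh b))) N) @ \oo -->
  A - B - X * Y * t * A + (X ^+ 2 + Y ^+ 2 - 2) * t ^+ 2 * A
  + (1 + q) * t ^+ 2 * B - X * Y * t ^+ 3 * A + t ^+ 4 * A - q * t ^+ 4 * B.
  apply: cvgB; last by apply: cZ; do 4 apply/cs.
  apply: cvgD; last by apply: cZ; do 4 apply/cs.
  apply: cvgB; last by apply: cZ; do 3 apply/cs.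
  apply: cvgD; last by apply: cZ; do 2 apply/cs.
  apply: cvgD; last by apply: cZ; do 2 apply/cs.
  apply: cvgB; last by apply: cZ; apply/cs.
  exact: cvgB.
suff e0 : A - B - X * Y * t * A + (X ^+ 2 + Y ^+ 2 - 2) * t ^+ 2 * A
  + (1 + q) * t ^+ 2 * B - X * Y * t ^+ 3 * A + t ^+ 4 * A - q * t ^+ 4 * B = 0.
  by apply/eqP; rewrite -subr_eq0 -[X in _ == X]e0 /wnorm; apply/eqP; ring.
apply: (cvg_unique _ cL) => //.
rewrite (_ : (fun N => _) = (fun=> 0)); first exact: cvg_cst.
apply/funext => N; rewrite /s; elim: N => [|N IH]; first by rewrite !series0; ring.
by rewrite !seriesSr -[RHS]addr0 -{1}IH -(pt N); ring.
Qed.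

(** Each use of the q-difference equation yields two consecutive factors of the q-Pochhammer symbol,
    hence the length [N * 2]. *)
Lemma mehler_iter (R : realType) (q X Y t : R) (N : nat) :
  `|q| < 1 -> `|X| <= 2 -> `|Y| <= 2 -> `|t| < 1 ->
  partial_prod (fun k => wnorm X Y (t * q ^+ k)) N * limn (series (mehler q X Y t))
  = qpoch (t ^+ 2) q (N * 2) * limn (series (mehler q X Y (t * q ^+ N))).
Proof.
move=> hq hX hY ht; elim: N => [|N IH].
  by rewrite /partial_prod big_nil qpoch0 expr0 mulr1.
have htq : `|t * q ^+ N| < 1.
  rewrite normrM; apply: le_lt_trans ht; apply: ler_piMr => //.
  by rewrite normrX; apply: exprn_ile1 => //; exact: ltW.
have e := mehler_qdiff hq hX hY htq.
rewrite partial_prodS mulrAC IH -mulrA [X in _ * X = _]mulrC e mulSn !addSn add0n !qpochS.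
have -> : t * q ^+ N.+1 = t * q ^+ N * q by rewrite exprS; ring.
by rewrite [q ^+ (N * 2).+1]exprS [q ^+ (N * 2)]exprM; ring.
Qed.

(** The limit of [mehler_iter], since the kernel at [t q^N] tends to 1. In this multiplicative form
    the positive right side shows that neither the product nor the kernel vanishes. *)
Lemma poisson_mehler (R : realType) (q X Y t : R) :
  `|q| < 1 -> `|X| <= 2 -> `|Y| <= 2 -> `|t| < 1 ->
  cvgn (partial_prod (fun k => wnorm X Y (t * q ^+ k))) /\
  infprod (fun k => wnorm X Y (t * q ^+ k)) * limn (series (mehler q X Y t))
  = qpoch_inf (t ^+ 2) q.
Proof.
move=> hq hX hY ht.
set f := fun k => wnorm X Y (t * q ^+ k).
have cf : cvgn (partial_prod f).
  pose K := `|X * Y| + `|X ^+ 2 + Y ^+ 2 - 2| + `|X * Y| + 1.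
  apply: (@partial_prod_cvg _ f K `|q|) => // n; rewrite /f; set u := t * q ^+ n.
  have uq : `|u| <= `|q| ^+ n.
    by rewrite normrM normrX; apply: ler_piMl; [exact: exprn_ge0|exact: ltW].
  have q1 : `|q| ^+ n <= 1 by apply: exprn_ile1 => //; exact: ltW.
  have u1 : `|u| <= 1 by exact: le_trans uq q1.
  have uX (a : R) m : `|a * u ^+ m| <= `|a|.
    by rewrite normrM normrX; apply: ler_piMr => //; apply: exprn_ile1.
  have -> : wnorm X Y u - 1 = u * (- (X * Y * u ^+ 0) + (X ^+ 2 + Y ^+ 2 - 2) * u ^+ 1
    - X * Y * u ^+ 2 + 1 * u ^+ 3) by rewrite /wnorm expr0 expr1; ring.
  rewrite normrM mulrC; apply: ler_pM => //.
  apply: le_trans (ler_normD _ _) _; apply: lerD; last by apply: le_trans (uX _ _) _; rewrite normr1.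
  apply: le_trans (ler_normB _ _) _; apply: lerD; last exact: uX.
  by apply: le_trans (ler_normD _ _) _; rewrite normrN; apply: lerD; exact: uX.
split => //.
have cL : (fun N => partial_prod f N * limn (series (mehler q X Y t))) @ \oo
    --> infprod f * limn (series (mehler q X Y t)).
  by apply: cvgM => //; exact: cvg_cst.
apply: (cvg_unique _ cL) => //.
suff : (fun N => partial_prod f N * limn (series (mehler q X Y t))) @ \oo
    --> qpoch_inf (t ^+ 2) q by [].
have -> : (fun N => partial_prod f N * limn (series (mehler q X Y t)))
  = (fun N => qpoch (t ^+ 2) q (N * 2) * limn (series (mehler q X Y (t * q ^+ N)))).
  by apply/funext => N; exact: mehler_iter.
rewrite -[X in _ --> X]mulr1; apply: cvgM.
  have c2 : (fun N => (N * 2)%N) @ \oo --> \oo.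
    move=> A [N _ hN]; exists N => // n /= Nn; apply: hN => /=.
    by apply: leq_trans Nn _; rewrite leq_pmulr.
  have cq : qpoch (t ^+ 2) q @ \oo --> qpoch_inf (t ^+ 2) q by exact: qpoch_cvg.
  exact: (cvg_comp (fun N => (N * 2)%N) (qpoch (t ^+ 2) q) c2 cq).
have [C hC] := mehler_near0 hq hX hY ht.
apply/subr_cvg0.
apply: (geometric_bound_cvg0 (normr_ge0 q) hq hC).
Qed.

(** * The generalized kernel *)

(* The sum over m of r^m B_m(y|q) P_m(x|y,r,q) / ([m]_q! (r^2;q)_m), the value
   at t = 0 of the kernel below. *)
Definition mehler_inv (R : realType) (q X Y r : R) : R :=
  limn (series (fun m => asc2 q 0 0 r Y m / qpoch q q m
                         * (asc2 q 1 X r Y m / qpoch (r ^+ 2) q m))).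

Lemma asc2_kernel (R : realType) (q X Y Z t r : R) :
  `|q| < 1 -> `|X| <= 2 -> `|Z| <= 2 -> `|t| < 1 -> `|r| < 1 ->
  series (fun n => asc2 q 1 X r Y n / qpoch (r ^+ 2) q n
                   * (asc2 q t Z r Y n / qpoch q q n)) @ \oo
  --> limn (series (mehler q X Z t)) * mehler_inv q X Y r.
Proof.
move=> hq hX hZ ht hr.
(* One rate serves all sequences: [c] is of order [|r|^m <= k^(4m) <= k^(2m)], [d] of order
   [k^(4n) k^(-n) = k^(3n)], and [p] of order [k^(-n)]. *)
have [k [k0 k1 hk]] : exists k : R, [/\ 0 < k, k < 1 & Num.max `|t| `|r| <= k ^+ 4].
  by apply: fourth_root_bound; [rewrite le_max normr_ge0|rewrite gt_max ht hr].
have [tk rk] : `|t| <= k ^+ 4 /\ `|r| <= k ^+ 4 by move: hk; rewrite ge_max => /andP.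
have s1 : 1 < k^-1 by rewrite invf_gt1.
have k00 := ltW k0.
have r2 : `|r ^+ 2| < 1 by rewrite normrX exprn_ilt1.
have [dq dq0 hdq] := qpoch_lower hq hq.
have [dr dr0 hdr] := qpoch_lower hq r2.
have div_bound (d : R) (u v : R^nat) (C s : R) : 0 < d -> (forall n, d <= v n) ->
    (forall n, `|u n| <= C * s ^+ n) -> forall n, `|u n / v n| <= C / d * s ^+ n.
  move=> d0 hv hu n; have v0 : 0 < v n by exact: lt_le_trans (hv n).
  rewrite normrM normfV (ger0_norm (ltW v0)) mulrAC; apply: ler_pM => //.
    by rewrite invr_ge0 ltW.
  by rewrite lef_pV2.
have [A A0 hA] := asc2_growth 0 0 hq hZ s1.
have [D D0 hD] := asc2_growth r Y hq hX s1.
have [C C0 hC] := asc2_0_bounded 0 Y hq.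
pose c m := asc2 q 0 0 r Y m / qpoch q q m.
pose d n := asc2 q t Z 0 0 n / qpoch q q n.
pose p n := asc2 q 1 X r Y n / qpoch (r ^+ 2) q n.
pose h n := asc2 q 1 X 0 0 n.
have scale_t n : asc2 q t Z 0 0 n = t ^+ n * asc2 q 1 Z 0 0 n.
  by rewrite -asc2_scale mulr0 mulr1.
have bc m : `|c m| <= C / dq * (k ^+ 2) ^+ m.
  apply: (div_bound dq (asc2 q 0 0 r Y) (qpoch q q)) => // n.
  have -> : asc2 q 0 0 r Y n = r ^+ n * asc2 q 0 0 1 Y n.
    by rewrite -asc2_scale mulr0 mulr1.
  rewrite normrM normrX mulrC.
  apply: ler_pM => //; rewrite ?exprn_ge0 //.
  apply: lerXn2r; rewrite ?nnegrE ?exprn_ge0 //; apply: le_trans rk _.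
  by apply: ler_wiXn2l => //; exact: ltW.
have bd n : `|d n| <= A / dq * (k ^+ 3) ^+ n.
  apply: (div_bound dq (asc2 q t Z 0 0) (qpoch q q)) => // m.
  rewrite scale_t normrM normrX.
  apply: le_trans (ler_pM (exprn_ge0 _ (normr_ge0 _)) (normr_ge0 _)
    (lerXn2r m _ _ tk) (hA m)) _; rewrite ?nnegrE ?exprn_ge0 //.
  rewrite mulrCA -exprMn; apply: ler_wpM2l => //.
  have -> : k ^+ 4 * k^-1 = k ^+ 3 by field; rewrite gt_eqF.
  by [].
have bp n : `|p n| <= D / dr * k^-1 ^+ n.
  exact: (div_bound dr (asc2 q 1 X r Y) (qpoch (r ^+ 2) q)).
(* Division by [(r^2;q)_n] moves the factor [1 - r^2 q^(n-1)] off the last term, giving the form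
   needed for the Abel summation. *)
have hp n : (1 - r ^+ 2 * q ^+ n) * p n.+1
            = (X - r * Y * q ^+ n) * p n - (1 - q ^+ n) * p n.-1.
  have P m : qpoch (r ^+ 2) q m != 0 by rewrite gt_eqF // qpoch_gt0.
  have F m : 1 - r ^+ 2 * q ^+ m != 0.
    by rewrite gt_eqF //; apply: lt_le_trans (qfactor_ge _ m hq); rewrite subr_gt0.
  rewrite /p; case: n => [|n].
    have -> : asc2 q 1 X r Y 1 = 1 * X - r * Y by [].
    have -> : asc2 q 1 X r Y 0 = 1 by [].
    by rewrite qpochS qpoch0; field; have := F 0%N; rewrite expr0 mulr1.
  rewrite succnK asc2SS !qpochS; field.
  by rewrite !(P, F).
have hS := shifted_series_lim (@asc2_eq_asc2 _ q 0 0 r Y hq) hp hq k0 k1 bc bp.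
have hM : series (fun n => d n * h n) @ \oo --> limn (series (mehler q X Z t)).
  have -> : (fun n => d n * h n) = mehler q X Z t; last exact: mehler_cvg.
  apply/funext => n; rewrite /d /h /mehler /mehler_coef.
  by rewrite scale_t; ring.
have := kernel_series_cvg k0 k1 bc bp bd hS hM.
have -> : (fun n => p n * convol d c n) = (fun n => p n * (asc2 q t Z r Y n / qpoch q q n)).
  by apply/funext => n; rewrite asc2_convol.
by [].
Qed.

(** At [Z = Y], [t = r] every partial sum of [asc2_kernel] past the empty one equals 1, by
    [asc2_diag]. *)
Lemma mehler_inv_mul (R : realType) (q X Y r : R) :
  `|q| < 1 -> `|X| <= 2 -> `|Y| <= 2 -> `|r| < 1 ->
  limn (series (mehler q X Y r)) * mehler_inv q X Y r = 1.
Proof.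
move=> hq hX hY hr.
have cK := asc2_kernel (Y := Y) hq hX hY hr hr.
rewrite -(cvg_lim (@Rhausdorff R) cK); apply: cvg_lim => //.
set f := (X in series X) in cK *.
have f1 n : series f n.+1 = 1.
  elim: n => [|n IH]; first by rewrite seriesSr series0 /f !qpoch0 /=; field.
  by rewrite seriesSr IH /f asc2_diag; ring.
rewrite -cvg_shiftS (_ : (fun n => series f n.+1) = fun=> 1); first exact: cvg_cst.
by apply/funext.
Qed.

(** * Positivity of w, and the return to the original variables *)

Lemma wfun_wnorm (R : realType) (q k x y t : R) :
  k ^+ 2 = 1 - q -> wfun q x y t = wnorm (k * x) (k * y) t.
Proof. by move=> hk; rewrite /wfun /wnorm -hk; ring. Qed.

(** For [t >= 0] the subtracted term is at most [(2 t (1 - a b))^2], the difference being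
    [(2 t (a - b))^2], and [2 t (1 - a b) <= 1 + t^2 - 2 t a b] amounts to [(1 - t)^2 >= 0].
    Negative [t] is symmetric. *)
Lemma wnorm_ge0 (R : realType) (X Y t : R) : `|X| <= 2 -> `|Y| <= 2 ->
  0 <= wnorm X Y t.
Proof.
move=> hX hY.
have sq (Z : R) : `|Z| <= 2 -> Z ^+ 2 <= 4.
  by move=> hZ; rewrite -[Z ^+ 2]real_normK ?num_real //; have := normr_ge0 Z; nra.
set a := X / 2; set b := Y / 2.
have a1 : 0 <= 1 - a ^+ 2 by rewrite /a expr_div_n; have := sq _ hX; lra.
have b1 : 0 <= 1 - b ^+ 2 by rewrite /b expr_div_n; have := sq _ hY; lra.
have ab : `|a * b| <= 1.
  rewrite -(@ler_pXn2r _ 2) ?nnegrE // expr1n real_normK ?num_real // exprMn.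
  by have := sqr_ge0 a; have := sqr_ge0 b; nra.
move: ab; rewrite ler_norml => /andP[ab1 ab2].
have -> : wnorm X Y t = (1 + t ^+ 2 - 2 * t * (a * b)) ^+ 2
    - 4 * t ^+ 2 * ((1 - a ^+ 2) * (1 - b ^+ 2)) by rewrite /wnorm /a /b; field.
rewrite subr_ge0.
case: (leP 0 t) => t0.
- apply: (@le_trans _ _ ((2 * t * (1 - a * b)) ^+ 2)).
    rewrite -subr_ge0.
    have -> : (2 * t * (1 - a * b)) ^+ 2 - 4 * t ^+ 2 * ((1 - a ^+ 2) * (1 - b ^+ 2))
      = (2 * t * (a - b)) ^+ 2 by ring.
    exact: sqr_ge0.
  have h0 : 0 <= 2 * t * (1 - a * b) by apply: mulr_ge0; lra.
  have h1 : 2 * t * (1 - a * b) <= 1 + t ^+ 2 - 2 * t * (a * b).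
    by have := sqr_ge0 (1 - t); lra.
  by apply: lerXn2r => //; rewrite nnegrE //; exact: le_trans h1.
- apply: (@le_trans _ _ ((- 2 * t * (1 + a * b)) ^+ 2)).
    rewrite -subr_ge0.
    have -> : (- 2 * t * (1 + a * b)) ^+ 2 - 4 * t ^+ 2 * ((1 - a ^+ 2) * (1 - b ^+ 2))
      = (2 * t * (a + b)) ^+ 2 by ring.
    exact: sqr_ge0.
  have h0 : 0 <= - 2 * t * (1 + a * b) by apply: mulr_ge0; lra.
  have h1 : - 2 * t * (1 + a * b) <= 1 + t ^+ 2 - 2 * t * (a * b).
    by have := sqr_ge0 (1 + t); lra.
  by apply: lerXn2r => //; rewrite nnegrE //; exact: le_trans h1.
Qed.

Lemma Sq_bound (R : realType) (q x : R) : q < 1 -> Sq q x ->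
  `|Num.sqrt (1 - q) * x| <= 2.
Proof.
move=> q1; rewrite /Sq /= in_itv /= => /andP[h1 h2].
have k0 : 0 < Num.sqrt (1 - q) by rewrite sqrtr_gt0; lra.
rewrite ler_norml; apply/andP; split.
  by rewrite mulrC -ler_pdivrMr // mulNr.
by rewrite mulrC -ler_pdivlMr.
Qed.

(** Each polynomial takes a factor [k^n]; together they give [(1-q)^n], which turns [qfact q n] into
    [(q;q)_n]. The power [rho1 ^+ n] clears the denominators of [rho2 / rho1]. *)
Lemma asc_term_asc2 (R : realType) (q x y z rho1 rho2 k : R) (n : nat) :
  `|q| < 1 -> `|rho2| < 1 -> rho1 != 0 -> k ^+ 2 = 1 - q ->
  asc_term q x y z rho1 rho2 n
  = asc2 q 1 (k * x) rho2 (k * y) n / qpoch (rho2 ^+ 2) q n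
    * (asc2 q rho1 (k * z) rho2 (k * y) n / qpoch q q n).
Proof.
move=> hq hr r0 hk.
have q0 : 1 - q != 0 by have := subr1X_neq0 0 hq; rewrite expr1.
have P m : qpoch q q m != 0 by rewrite gt_eqF // qpoch_gt0.
have P2 m : qpoch (rho2 ^+ 2) q m != 0.
  by rewrite gt_eqF // qpoch_gt0 // normrX exprn_ilt1.
have f0 : qfact q n != 0.
  by have := P n; rewrite -qfact_mul mulf_eq0 negb_or => /andP[].
rewrite -(asc_asc2 x rho2 y n hk (oner_neq0 _)) -(asc_asc2 z rho2 y n hk r0).
rewrite divr1 expr1n mulr1 -qfact_mul -hk -exprM mulnC exprM /asc_term.
have k0 : k ^+ n != 0.
  by rewrite expf_neq0 //; apply: contra_neq q0 => k0; rewrite -hk k0 expr2 mul0r.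
by field; rewrite f0 P2 k0.
Qed.

Lemma asc_term_cvg (R : realType) (q rho1 rho2 x y z k : R) :
  `|q| < 1 -> `|rho1| < 1 -> `|rho2| < 1 -> rho1 != 0 -> k ^+ 2 = 1 - q ->
  `|k * x| <= 2 -> `|k * z| <= 2 ->
  series (asc_term q x y z rho1 rho2) @ \oo
  --> limn (series (mehler q (k * x) (k * z) rho1))
      * mehler_inv q (k * x) (k * y) rho2.
Proof.
move=> hq h1 h2 r0 hk hx hz.
have -> : asc_term q x y z rho1 rho2 =
  (fun n => asc2 q 1 (k * x) rho2 (k * y) n / qpoch (rho2 ^+ 2) q n
            * (asc2 q rho1 (k * z) rho2 (k * y) n / qpoch q q n)).
  by apply/funext => n; exact: asc_term_asc2.
exact: asc2_kernel.
Qed.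

Theorem mainTheorem2 (R : realType) (q rho1 rho2 x y z : R)
  (hq : `|q| < 1) (hrho1 : `|rho1| < 1) (hrho2 : `|rho2| < 1)
  (hrho1_neq0 : rho1 != 0) (hrho2_neq0 : rho2 != 0)
  (hx : Sq q x) (hy : Sq q y) (hz : Sq q z) :
  (* convergence of the series and infinite products involved *)
  [/\ cvgn (series (asc_term q x y z rho1 rho2)),
      cvgn (series (asc_term q x z y rho2 rho1)),
      cvgn (qpoch (rho1 ^+ 2) q),
      cvgn (qpoch (rho2 ^+ 2) q) &
      cvgn (partial_prod (fun k => wfun q x y (rho2 * q ^+ k)
                                   / wfun q x z (rho1 * q ^+ k)))] /\
  [/\ 0 <= limn (series (asc_term q x y z rho1 rho2)),
      limn (series (asc_term q x y z rho1 rho2)) =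
        qpoch_inf (rho1 ^+ 2) q / qpoch_inf (rho2 ^+ 2) q
        * infprod (fun k => wfun q x y (rho2 * q ^+ k)
                            / wfun q x z (rho1 * q ^+ k)) &
      1 = limn (series (asc_term q x y z rho1 rho2))
          * limn (series (asc_term q x z y rho2 rho1))].
Proof.
have q1 : q < 1 by apply: le_lt_trans (ler_norm q) hq.
set k := Num.sqrt (1 - q).
have hk : k ^+ 2 = 1 - q by rewrite sqr_sqrtr // subr_ge0 ltW.
have kx : `|k * x| <= 2 by exact: Sq_bound.
have ky : `|k * y| <= 2 by exact: Sq_bound.
have kz : `|k * z| <= 2 by exact: Sq_bound.
have c1 := asc_term_cvg (y := y) hq hrho1 hrho2 hrho1_neq0 hk kx kz.
have c2 := asc_term_cvg (y := z) hq hrho2 hrho1 hrho2_neq0 hk kx ky.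
have [p1 e1] := poisson_mehler hq kx kz hrho1.
have [p2 e2] := poisson_mehler hq kx ky hrho2.
have i1 := mehler_inv_mul hq kx kz hrho1.
have i2 := mehler_inv_mul hq kx ky hrho2.
have sq_lt (r : R) : `|r| < 1 -> `|r ^+ 2| < 1.
  by move=> hr; rewrite normrX exprn_ilt1.
have g1 := qpoch_inf_gt0 hq (sq_lt _ hrho1).
have g2 := qpoch_inf_gt0 hq (sq_lt _ hrho2).
set w1 := fun i => wnorm (k * x) (k * z) (rho1 * q ^+ i) in p1 e1.
set w2 := fun i => wnorm (k * x) (k * y) (rho2 * q ^+ i) in p2 e2.
set M1 := limn (series (mehler q (k * x) (k * z) rho1)) in c1 e1 i1.
set M2 := limn (series (mehler q (k * x) (k * y) rho2)) in c2 e2 i2.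
set N1 := mehler_inv q (k * x) (k * z) rho1 in c2 i1.
set N2 := mehler_inv q (k * x) (k * y) rho2 in c1 i2.
have l1 := cvg_lim (@Rhausdorff R) c1.
have l2 := cvg_lim (@Rhausdorff R) c2.
have W1 : infprod w1 != 0.
  by apply/eqP => W0; move: g1; rewrite -e1 W0 mul0r ltxx.
have W2 : infprod w2 != 0.
  by apply/eqP => W0; move: g2; rewrite -e2 W0 mul0r ltxx.
have M20 : M2 != 0 by apply/eqP => M0; move: g2; rewrite -e2 M0 mulr0 ltxx.
have eN2 : N2 = M2^-1 by apply: (mulfI M20); rewrite i2 divff.
have cW : partial_prod (fun i => wfun q x y (rho2 * q ^+ i)
                                 / wfun q x z (rho1 * q ^+ i)) @ \oo
          --> infprod w2 / infprod w1.
  have -> : partial_prod (fun i => wfun q x y (rho2 * q ^+ i)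
                                   / wfun q x z (rho1 * q ^+ i))
            = (fun n => partial_prod w2 n / partial_prod w1 n).
    apply/funext => n; rewrite /partial_prod -prodf_div; apply: eq_bigr => i _.
    by rewrite !(wfun_wnorm _ _ _ hk).
  by apply: cvgM => //; apply: cvgV.
have lW := cvg_lim (@Rhausdorff R) cW.
have W_ge0 w : cvgn (partial_prod w) -> (forall i, 0 <= w i) -> 0 <= infprod w.
  move=> cw w0; apply: limr_ge => //; exists 0%N => // n _.
  exact: prodr_ge0.
have main : limn (series (asc_term q x y z rho1 rho2)) =
        qpoch_inf (rho1 ^+ 2) q / qpoch_inf (rho2 ^+ 2) q
        * infprod (fun i => wfun q x y (rho2 * q ^+ i)
                            / wfun q x z (rho1 * q ^+ i)).
  rewrite l1 /infprod lW eN2 -e1 -e2; field.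
  by rewrite W1 W2 M20.
split; first split.
- by apply/cvg_ex; eexists; exact: c1.
- by apply/cvg_ex; eexists; exact: c2.
- exact: qpoch_cvg.
- exact: qpoch_cvg.
- by apply/cvg_ex; eexists; exact: cW.
split => //.
- rewrite main /infprod lW.
  have w1g : 0 <= infprod w1 by apply: W_ge0 => // i; exact: wnorm_ge0.
  have w2g : 0 <= infprod w2 by apply: W_ge0 => // i; exact: wnorm_ge0.
  by rewrite !mulr_ge0 ?invr_ge0 // ltW.
(* The two sums are [M1 * N2] and [M2 * N1]; regrouping pairs each kernel with its own inverse. *)
- rewrite l1 l2; transitivity ((M1 * N1) * (M2 * N2)); last by ring.
  by rewrite i1 i2 mulr1.
Qed.
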